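(* Let $k\ge0$ and $m\ge1$, and let $X=\{x_1,\dots,x_n\}$ be a finite pseudo-metric space. Let $j_1\le\dots\le j_m$ be indices in $\{1,\dots,n\}$, and consider the multiset $Z=X\sqcup\{x_{j_1},\dots,x_{j_m}\}$ with the pseudo-metric inherited from $X$. Then $$\mathcal{B}_{\mathrm{Ver},k}(Z)=\mathcal{B}_{\mathrm{Ver},k}(X)\sqcup\bigsqcup_{i=0}^{m-1}\ \bigsqcup_{\beta_i\in P_k\left((X\setminus\{x_{j_{i+1}}\})\sqcup\{x_{j_1},\dots,x_{j_i}\}\right)}\left\{\operatorname{diam}(\{x_{j_{i+1}}\}\sqcup\beta_i)\cdot(1,1)\right\}.$$ In particular, $$\mathcal{B}_{\mathrm{Ver},0}(Z)=\mathcal{B}_{\mathrm{Ver},0}(X)\sqcup\bigsqcup_{i=0}^{m-1}\{\operatorname{diam}(\{x_{j_{i+1}}\})\cdot(1,1)\}=\mathcal{B}_{\mathrm{Ver},0}(X)\sqcup\{(0,0)\}^m.$$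
   Context: Fix a field $\mathbb{F}$. All unions $\sqcup$ are multiset unions (multiplicities add); $r\cdot(1,1)=(r,r)$; $\{x\}^m$ is the multiset of $m$ copies of $x$. The multiset $Z$ is regarded as a pseudo-metric space with $n+m$ distinct points: each added copy of $x_j$ is a new point, and distances are those of the corresponding points of $X$ (so a copy is at distance $0$ from its original). For a multiset $A$, $P_l(A)$ is the collection of all sub-multisets of $A$ of cardinality $l$, where different copies of a repeated element are regarded as different elements (so $P_l(A)$ has $\binom{\operatorname{card}(A)}{l}$ members); $P_0(A)=\{\emptyset\}$. Vietoris–Rips FCC. For a finite pseudo-metric space $(X,d_X)$, $C_*(\mathrm{VR}(X))$ is the simplicial chain complex over $\mathbb{F}$ of the full simplex on the vertex set $X$ (points at distance $0$ remain distinct vertices), with filtration function $\ell^X(\sum\lambda_i\sigma_i)=\max_{\lambda_i\ne0}\operatorname{diam}(\sigma_i)$ (distinct simplices $\sigma_i$), $\ell^X(0)=-\infty$. Elements $x_1,\dots,x_r$ of the complex are orthogonal if $\ell^X(\sum\lambda_ix_i)=\max_{\lambda_i\ne0}\ell^X(x_i)$ for all scalars. Verbose barcode. For $k\ge0$, choose orthogonal ordered bases $(y_1,\dots,y_a)$ of $C_{k+1}$ and $(w_1,\dots,w_b)$ of $\ker\partial_k$ such that, with $r=\operatorname{rank}\partial_{k+1}$, $(y_{r+1},\dots,y_a)$ is a basis of $\ker\partial_{k+1}$, $(w_1,\dots,w_r)$ is a basis of $\operatorname{im}\partial_{k+1}$, and $\partial_{k+1}y_i=w_i$ for $i\le r$.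 The degree-$k$ verbose barcode $\mathcal{B}_{\mathrm{Ver},k}(X)$ is the multiset of pairs $(\ell^X(w_i),\ell^X(y_i))$, $i\le r$, and $(\ell^X(w_i),\infty)$, $r<i\le b$. It does not depend on the choices. *)

(* Defs.v *)
From HB Require Import structures.
From mathcomp Require Import all_boot all_order all_algebra.
From mathcomp Require Import finmap multiset.
From mathcomp Require Import boolp classical_sets reals constructive_ereal.

Set Implicit Arguments.
Unset Strict Implicit.
Unset Printing Implicit Defensive.

Import Order.TTheory GRing.Theory Num.Theory.
Local Open Scope ring_scope.

HB.instance Definition _ (K : choiceType) :=
  Monoid.isComLaw.Build {mset K}%mset mset0 (@msetD K)
    (@msetDA K) (@msetDC K) (@mset0D K).

Record pseudometric (R : realType) (T : Type) (d : T -> T -> R) : Prop := {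
  pseudometric_ge0 : forall x y, 0 <= d x y;
  pseudometric_refl : forall x, d x x = 0;
  pseudometric_sym : forall x y, d x y = d y x;
  pseudometric_triangle : forall x y z, d x z <= d x y + d y z }.

(* Distances are nonnegative, so the base value 0 does not affect the maximum
   over a nonempty set. *)
Definition diam (R : realType) (T : finType) (d : T -> T -> R) (s : {set T}) :
    R :=
  \big[Num.max/0]_(u in s) \big[Num.max/0]_(v in s) d u v.

Section SimplicialChains.
Variables (F : fieldType) (T : finType).

Definition simplex (k : nat) := {s : {set T} | #|s| == k.+1}.

Definition chain (k : nat) := {ffun simplex k -> F^o}.

(* Takes a bare set so that faces need no cardinality proof; it is the zero
   chain when #|s| is not k.+1. *)
Definition simplex_chain (k : nat) (s : {set T}) : chain k :=
  [ffun t => (val t == s)%:R].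

(* Vertices are ordered by their rank in the enumeration of T, and every simplex
   is oriented by increasing rank. *)
Definition vertex_pos (s : {set T}) (v : T) : nat :=
  #|[set u in s | (enum_rank u < enum_rank v)%N]|.

Definition bd_fun (k : nat) (c : chain k.+1) : chain k :=
  \sum_(s : simplex k.+1) c s *:
    \sum_(v in val s)
      (-1) ^+ vertex_pos (val s) v *: simplex_chain k (val s :\ v)%SET.

Fact bd_fun_is_linear k : linear (@bd_fun k).
Proof.
move=> a u v; rewrite /bd_fun scaler_sumr -big_split /=; apply: eq_bigr => s _.
by rewrite !ffunE scalerDl scalerA.
Qed.

HB.instance Definition _ k :=
  GRing.isLinear.Build F (chain k.+1) (chain k) _ (@bd_fun k)
    (@bd_fun_is_linear k).

(* The boundary map of degree k.+1; the complex is not augmented, so the one of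
   degree 0 is zero. *)
Definition bd (k : nat) : 'Hom(chain k.+1, chain k) := linfun (@bd_fun k).

Definition cycles (k : nat) : {vspace chain k} :=
  match k with
  | 0 => fullv
  | k'.+1 => lker (bd k')
  end.

End SimplicialChains.

Section VerboseBarcode.
Variables (F : fieldType) (R : realType) (T : finType) (d : T -> T -> R).

Definition filt (k : nat) (c : chain F T k) : \bar R :=
  \big[maxe/-oo%E]_(s : simplex T k | c s != 0) (diam d (val s))%:E.

Definition orthogonal_family (k : nat) (x : seq (chain F T k)) : Prop :=
  forall lam : 'I_(size x) -> F,
    filt (\sum_(i < size x) lam i *: x`_i) =
    \big[maxe/-oo%E]_(i < size x | lam i != 0) filt x`_i.

Record barcode_bases (k : nat)
    (y : seq (chain F T k.+1)) (w : seq (chain F T k)) : Prop := {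
  bases_orthogonal_y : orthogonal_family y;
  bases_orthogonal_w : orthogonal_family w;
  bases_y : basis_of fullv y;
  bases_w : basis_of (cycles F T k) w;
  bases_ker : basis_of (lker (bd F T k)) (drop (\dim (limg (bd F T k))) y);
  bases_im : basis_of (limg (bd F T k)) (take (\dim (limg (bd F T k))) w);
  bases_bd : forall i, (i < \dim (limg (bd F T k)))%N -> bd F T k y`_i = w`_i }.

Definition barcode_of_bases (k : nat)
    (y : seq (chain F T k.+1)) (w : seq (chain F T k)) :
    {mset (\bar R * \bar R)%type}%mset :=
  let r := \dim (limg (bd F T k)) in
  seq_mset ([seq (filt w`_i, filt y`_i) | i <- iota 0 r] ++
            [seq (filt u, +oo%E) | u <- drop r w]).

(* Such bases always exist (singular value decomposition of non-Archimedean
   normed spaces) and all of them give the same multiset; mset0 is only the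
   formal default value of xget. *)
Definition verbose_barcode (k : nat) : {mset (\bar R * \bar R)%type}%mset :=
  xget mset0 [set B | exists y w, @barcode_bases k y w /\
                                  B = barcode_of_bases y w]%classic.

End VerboseBarcode.

(* The n + m points of Z: inl a is the original point of index a, and inr b is
   the b-th added copy, a copy of the point of index j b. *)
Definition original (n m : nat) (j : 'I_m -> 'I_n) (z : 'I_n + 'I_m) : 'I_n :=
  match z with inl a => a | inr b => j b end.

Definition copies_dist (R : realType) (n m : nat) (d : 'I_n -> 'I_n -> R)
    (j : 'I_m -> 'I_n) (z z' : 'I_n + 'I_m) : R :=
  d (original j z) (original j z').

(* With i counted from 0, the multiset obtained from X by removing the point of
   index j i and adding the copies preceding the i-th one. *)
Definition stage (n m : nat) (j : 'I_m -> 'I_n) (i : 'I_m) :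
    {set 'I_n + 'I_m} :=
  [set z : 'I_n + 'I_m |
    match z with inl a => a != j i | inr b => (b < i)%N end]%SET.

Definition subsets_of_card (T : finType) (l : nat) (A : {set T}) :
    {set {set T}} :=
  [set B : {set T} | (B \subset A) && (#|B| == l)]%SET.

(* Main.v *)
From HB Require Import structures.
Require Import Defs.
From mathcomp Require Import all_boot all_order all_algebra.
From mathcomp Require Import finmap multiset.
From mathcomp Require Import boolp classical_sets reals constructive_ereal.
From mathcomp Require Import ring.

(* The number of bars with birth at most a and death at most b is the dimension
   of bd(C_{k+1}^{<=b}) :&: C_k^{<=a}, or of Z_k :&: C_k^{<=a} when b is
   infinite, for any choice of bases; these numbers determine the barcode.
   Suitable bases exist: rank the simplices compatibly with their diameters and,
   for each (k+1)-simplex s, choose a chain with leading simplex s whose boundary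
   has the least possible leading simplex; the nonzero boundaries then have
   distinct leading simplices, and families with distinct leading simplices are
   orthogonal.

   Let z be a copy of x in A, outside A. Reading off the coefficients of the
   simplices z |: beta with x not in beta is a linear map on the above space for
   z |: A. Its kernel is the space for A (retract z onto x), and it maps onto the
   chains spanned by the beta with diam (x |: beta) <= min a b, a preimage of
   beta being the boundary of z |: (x |: beta) up to sign. So adding z adds
   exactly one bar (D, D), D = diam (x |: beta), for each beta. *)

Set Implicit Arguments.
Unset Strict Implicit.
Unset Printing Implicit Defensive.

Import Order.TTheory GRing.Theory Num.Theory.

(** * Filtered vector spaces *)

Section SupportSpace.
Variables (F : fieldType) (I : finType).
Local Open Scope ring_scope.
Local Notation V := {ffun I -> F^o}.

Definition restriction_fun (P : pred I) (c : V) : V :=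
  [ffun s => if P s then c s else 0].

Fact restriction_is_linear P : linear (restriction_fun P).
Proof.
move=> a u v; apply/ffunP=> s; rewrite !ffunE.
by case: (P s); rewrite ?scaler0 ?addr0.
Qed.

HB.instance Definition _ P :=
  GRing.isLinear.Build F V V _ (restriction_fun P) (restriction_is_linear P).

Definition supp_space (P : pred I) : {vspace V} :=
  lker (linfun (restriction_fun (predC P))).

Lemma supp_spaceP (P : pred I) (c : V) :
  reflect (forall s, c s != 0 -> P s) (c \in supp_space P).
Proof.
rewrite memv_ker lfunE; apply: (iffP eqP) => [/ffunP c0 s | cP].
  by apply: contraR => nPs; have := c0 s; rewrite !ffunE /= nPs => ->.
by apply/ffunP=> s; rewrite !ffunE /=; case: ifPn => //; apply: contraNeq; exact: cP.
Qed.

Definition delta (s : I) : V := [ffun t => (t == s)%:R].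

Lemma delta_sum (c : V) : c = \sum_s c s *: delta s.
Proof.
apply/ffunP=> t; rewrite sum_ffunE (bigD1 t) //= big1 => [|s nst]; last first.
  by rewrite !ffunE eq_sym (negPf nst) scaler0.
by rewrite !ffunE eqxx addr0 [_ *: _]mulr1.
Qed.

End SupportSpace.

(** * Leading indices with respect to an injective rank *)

Section Leads.
Variables (F : fieldType) (I : finType) (rho : I -> nat).
Hypothesis rho_inj : injective rho.
Local Open Scope ring_scope.
Local Notation V := {ffun I -> F^o}.

Definition lead (c : V) : option I :=
  [pick s | (c s != 0) && [forall t, (c t != 0) ==> (rho t <= rho s)%N]].

Lemma leadP (c : V) s :
  reflect (c s != 0 /\ forall t, c t != 0 -> (rho t <= rho s)%N)
          (lead c == Some s).
Proof.
rewrite /lead; case: pickP => [u /andP[cu /forallP mu] | none].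
  apply: (iffP eqP) => [[<-] | [cs ms]].
    by split=> // t ct; have := mu t; rewrite ct.
  congr Some; apply/rho_inj/eqP; rewrite eqn_leq ms //=.
  by have := mu s; rewrite cs.
apply: (iffP eqP) => // -[cs ms]; have := none s; rewrite cs /=.
by move/negP; case; apply/forallP=> t; apply/implyP; exact: ms.
Qed.

Lemma lead_exists (c : V) : c != 0 -> exists s, lead c = Some s.
Proof.
move=> nz; have [s0 cs0] : exists s, c s != 0.
  apply/existsP; apply: contraNT nz; rewrite negb_exists => /forallP c0.
  by apply/eqP/ffunP=> s; rewrite ffunE; apply/eqP; rewrite -[_ == _]negbK c0.
have [s cs ms] := @arg_maxnP _ s0 (fun s => c s != 0) rho cs0.
by exists s; apply/eqP/leadP; split=> // t ct; exact: ms.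
Qed.

Lemma lead_bounded (c : V) s t : lead c = Some s -> c t != 0 -> (rho t <= rho s)%N.
Proof. by move/eqP/leadP => [_]; apply. Qed.

Lemma lead_neq0 (c : V) s : lead c = Some s -> c s != 0.
Proof. by move/eqP/leadP => []. Qed.

Lemma lead_delta s : lead (delta F s) = Some s.
Proof.
apply/eqP/leadP; split=> [|t]; rewrite ffunE ?eqxx ?oner_eq0 //.
by have [->|] := eqVneq t s; rewrite // eqxx.
Qed.

Definition distinct_leads (x : seq V) := (0 \notin x) && uniq (map lead x).

(** Among the terms with nonzero coefficient take the one whose lead has the greatest rank. Leads
    being distinct, all other such terms vanish at that index, so nothing cancels there. The
    comparison of leads is kept in the conclusion for orthogonality. *)
Lemma lead_sum (x : seq V) (lam : 'I_(size x) -> F) :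
  distinct_leads x -> (exists i, lam i != 0) ->
  exists2 i0, lam i0 != 0 & (forall i, lam i != 0 ->
     exists s s0, [/\ lead x`_i = Some s, lead x`_i0 = Some s0
                     & (rho s <= rho s0)%N]) /\
     lead (\sum_(i < size x) lam i *: x`_i) = lead x`_i0.
Proof.
case/andP=> x0 ux [j lj].
have leadx (i : 'I_(size x)) : exists s, lead x`_i = Some s.
  by apply: lead_exists; apply: contraNneq x0 => <-; rewrite mem_nth.
(* The default 0 of [oapp] is never reached, since every entry of [x] is nonzero. *)
have [i0 li0 mi0] := @arg_maxnP _ j (fun i => lam i != 0)
   (fun i : 'I_(size x) => oapp rho 0%N (lead x`_i)) lj.
exists i0 => //; have [s0 es0] := leadx i0; split=> [i li|].
  have [s es] := leadx i; exists s, s0; split=> //.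
  by have := mi0 i li; rewrite es es0.
rewrite es0; apply/eqP/leadP; split.
  rewrite sum_ffunE (bigD1 i0) //= big1 => [|i nii0].
    by rewrite addr0 ffunE mulf_neq0 // (lead_neq0 es0).
  have [->|li] := eqVneq (lam i) 0; first by rewrite scale0r ffunE.
  apply/eqP; apply: contraNT nii0; rewrite ffunE => nz.
  have xi : x`_i s0 != 0 by apply: contraNneq nz => ->; rewrite scaler0.
  have [s es] := leadx i; have := mi0 i li; rewrite es es0 /= => le1.
  have ess0 : s = s0 by apply/rho_inj/eqP; rewrite eqn_leq le1 (lead_bounded es).
  have : lead x`_i == lead x`_i0 by rewrite es es0 ess0.
  by rewrite -!(nth_map 0 None lead) // nth_uniq ?size_map.
move=> t; rewrite sum_ffunE => nz.
have [i /andP[li xi]] : exists i, (lam i != 0) && (x`_i t != 0).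
  apply/existsP; apply: contraNT nz; rewrite negb_exists => /forallP z.
  rewrite big1 // => i _; rewrite ffunE; have := z i; rewrite negb_and !negbK.
  by case/orP=> /eqP ->; rewrite ?scale0r ?scaler0.
have [s es] := leadx i; have := mi0 i li; rewrite es es0 /= => le1.
exact: leq_trans (lead_bounded es xi) le1.
Qed.

(** A nontrivial combination has a lead, and the zero chain has none. *)
Lemma distinct_leads_free (x : seq V) : distinct_leads x -> free x.
Proof.
move=> dx; rewrite -[x]in_tupleE; apply/freeP => lam sum0 i.
apply/eqP; apply: contraT => li.
have [i0 _ [/(_ i li)[s [s0 [_ es0 _]]]]] :=
  lead_sum dx (ex_intro (fun i => lam i != 0) i li).
by rewrite es0 sum0 => /lead_neq0; rewrite ffunE eqxx.
Qed.

End Leads.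

Section SupportDimension.
Variables (F : fieldType) (I : finType).
Local Open Scope ring_scope.

Lemma dim_supp_space (P : pred I) : \dim (supp_space F P) = #|P|.
Proof.
have inj : injective (fun s : I => nat_of_ord (enum_rank s)).
  by move=> s t /ord_inj/enum_rank_inj.
pose x := [seq delta F s | s <- enum P].
have -> : supp_space F P = <<x>>%VS.
  apply/eqP; rewrite eqEsubv; apply/andP; split; last first.
    apply/span_subvP => _ /mapP[s sP ->]; apply/supp_spaceP => t.
    rewrite ffunE; have [->|] := eqVneq t s; last by rewrite eqxx.
    by rewrite mem_enum in sP.
  apply/subvP => c cP; rewrite (delta_sum c) rpred_sum // => s _.
  have [cs0|cs] := eqVneq (c s) 0; first by rewrite cs0 scale0r mem0v.
  rewrite rpredZ // memv_span //; apply/mapP; exists s => //.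
  by rewrite mem_enum; move/supp_spaceP: cP; apply.
have /eqnP -> : free x; last by rewrite size_map -cardE.
apply: (distinct_leads_free inj); apply/andP; split.
  apply/mapP => -[s _ e]; have := lead_neq0 inj (lead_delta F inj s).
  by rewrite -e ffunE eqxx.
rewrite -map_comp (eq_map (g := Some)); last by move=> s /=; rewrite lead_delta.
by rewrite map_inj_uniq ?enum_uniq // => ? ? [].
Qed.

End SupportDimension.

(** * Orthogonal families and sublevel spaces *)

Section Orthogonality.
Variables (F : fieldType) (R : realType) (I : finType) (w : I -> R).
Local Open Scope ring_scope.
Local Notation V := {ffun I -> F^o}.
Implicit Types (c : V) (x : seq V) (a : \bar R).

Definition weight_filt c : \bar R :=
  \big[maxe/-oo%E]_(s | c s != 0) (w s)%:E.

Definition weight_orthogonal x : Prop :=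
  forall lam : 'I_(size x) -> F,
    weight_filt (\sum_(i < size x) lam i *: x`_i) =
    \big[maxe/-oo%E]_(i < size x | lam i != 0) weight_filt x`_i.

Definition sublevel a : {vspace V} :=
  supp_space F (fun s => ((w s)%:E <= a)%E).

Lemma bigmaxe_leP (K : finType) (P : pred K) (g : K -> \bar R) a :
  reflect (forall i, P i -> (g i <= a)%E) (\big[maxe/-oo%E]_(i | P i) g i <= a)%E.
Proof.
apply: (iffP (bigmax_leP _ _ _ _)) => [[_]//|ga]; split=> //.
exact: leNye.
Qed.

Lemma mem_sublevel c a : (c \in sublevel a) = (weight_filt c <= a)%E.
Proof. by apply/supp_spaceP/bigmaxe_leP. Qed.

Lemma nth_iota_filter x (P : pred nat) : uniq x ->
  [seq x`_i | i <- iota 0 (size x) & P i] = filter (fun v => P (index v x)) x.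
Proof.
move=> ux; rewrite -{4}[x](mkseq_nth 0) filter_map; congr map.
apply: eq_in_filter => i; rewrite mem_iota add0n /= => ltix.
by rewrite index_uniq.
Qed.

(** Subfamilies are selected by a predicate on positions because the bars pair the entries of two
    bases by position. *)
Lemma span_iotaP x (P : pred nat) (u : V) : free x ->
  reflect (exists2 lam : nat -> F, (forall i, lam i != 0 -> P i) &
             u = \sum_(i < size x) lam i *: x`_i)
          (u \in <<[seq x`_i | i <- iota 0 (size x) & P i]>>%VS).
Proof.
move=> fx; apply: (iffP idP) => [ux|[lam Plam ->]]; last first.
  apply: rpred_sum => i _; have [->|li] := eqVneq (lam i) 0.
    by rewrite scale0r mem0v.
  rewrite rpredZ // memv_span //; apply/mapP; exists (i : nat) => //.
  by rewrite mem_filter Plam // mem_iota /= add0n ltn_ord.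
have fX : free [seq x`_i | i <- iota 0 (size x) & P i].
  by rewrite nth_iota_filter ?free_uniq // filter_free.
have [k -> _] := free_span fX ux.
exists (fun i => if P i then k x`_i else 0) => [i|].
  by case: ifP => //; rewrite eqxx.
rewrite big_map big_filter -{1}[size x]subn0 -/(index_iota 0 (size x)) big_mkord.
by rewrite big_mkcond; apply: eq_bigr => i _; case: ifP; rewrite ?scale0r.
Qed.

Lemma dim_span_iota x (P : pred nat) : free x ->
  \dim <<[seq x`_i | i <- iota 0 (size x) & P i]>> = count P (iota 0 (size x)).
Proof.
move=> fx; rewrite nth_iota_filter ?free_uniq // (eqnP (filter_free _ fx)).
rewrite size_filter -{2}[x](mkseq_nth 0) count_map.
apply: eq_in_count => i; rewrite mem_iota add0n /= => ltix.
by rewrite index_uniq // free_uniq.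
Qed.

(** By orthogonality the filtration value of a combination is the maximum over its terms with
    nonzero coefficient, so it is at most [a] exactly when each of these terms is. *)
Lemma orthogonal_span_sublevel x (P : pred nat) a :
  free x -> weight_orthogonal x ->
  (<<[seq x`_i | i <- iota 0 (size x) & P i]>> :&: sublevel a)%VS =
  <<[seq x`_i | i <- iota 0 (size x) & P i && (weight_filt x`_i <= a)%E]>>%VS.
Proof.
move=> fx ox; apply/vspaceP=> u; rewrite memv_cap mem_sublevel.
apply/andP/(span_iotaP _ _ fx) => [[/(span_iotaP _ _ fx)[lam Plam ->]]|[lam Plam ->]].
  rewrite (ox lam) => /bigmaxe_leP lea.
  exists (fun i => if (i < size x)%N then lam i else 0) => [i|]; last first.
    by apply: eq_bigr => i _; rewrite ltn_ord.
  case: ifP => [ltix li|]; last by rewrite eqxx.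
  by rewrite Plam // (lea (Ordinal ltix)).
split; first by apply/(span_iotaP _ _ fx); exists lam => // i /Plam/andP[].
by rewrite (ox lam); apply/bigmaxe_leP => i /Plam/andP[].
Qed.

Lemma dim_span_sublevel x (P : pred nat) a :
  free x -> weight_orthogonal x ->
  \dim (<<[seq x`_i | i <- iota 0 (size x) & P i]>> :&: sublevel a) =
  count (fun i => P i && (weight_filt x`_i <= a)%E) (iota 0 (size x)).
Proof. by move=> fx ox; rewrite orthogonal_span_sublevel // dim_span_iota. Qed.

Section CompatibleRank.
Variable rho : I -> nat.
Hypothesis rho_inj : injective rho.
Hypothesis rho_mono : forall s t, (rho s <= rho t)%N -> w s <= w t.

Lemma weight_filt_lead c s : lead rho c = Some s -> weight_filt c = (w s)%:E.
Proof.
move=> es; apply/eqP; rewrite eq_le; apply/andP; split.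
  by apply/bigmaxe_leP => t ct; rewrite lee_fin rho_mono // (lead_bounded rho_inj es).
by apply: le_bigmax_cond; exact: (lead_neq0 rho_inj).
Qed.

(** The combination has the same lead as its term of top rank, hence the same filtration value; the
    other leads have lower rank and thus no larger weight. *)
Lemma distinct_leads_orthogonal x : distinct_leads rho x -> weight_orthogonal x.
Proof.
move=> dx lam; have [/existsP ex | none] := boolP [exists i, lam i != 0]; last first.
  rewrite negb_exists in none; move/forallP in none.
  have l0 i : lam i = 0 by apply/eqP; rewrite -[_ == _]negbK.
  rewrite [RHS]big_pred0; last by move=> i; rewrite l0 eqxx.
  rewrite big1 => [|i _]; last by rewrite l0 scale0r.
  by rewrite /weight_filt big_pred0 // => s; rewrite ffunE eqxx.
have [i0 li0 [mi0 el]] := lead_sum rho_inj dx ex.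
have [_ [s0 [_ es0 _]]] := mi0 _ li0.
rewrite es0 in el; rewrite (weight_filt_lead el).
apply/eqP; rewrite eq_le; apply/andP; split.
  rewrite -(weight_filt_lead es0).
  exact: (@le_bigmax_cond _ _ _ -oo%E i0 (fun i => lam i != 0)
            (fun i : 'I_(size x) => weight_filt x`_i)).
apply/bigmaxe_leP => i li; have [s [s1 [es es1 lerho]]] := mi0 i li.
rewrite (weight_filt_lead es) lee_fin rho_mono //.
by move: es1; rewrite es0 => -[->].
Qed.

End CompatibleRank.

(** The rank is the position in the list of indices sorted by weight, which also breaks ties. *)
Lemma compatible_rank : exists2 rho : I -> nat, injective rho &
  forall s t, (rho s <= rho t)%N -> w s <= w t.
Proof.
pose e := sort (relpre w <=%O) (enum I).
have eI s : s \in e by rewrite mem_sort mem_enum.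
exists (index^~ e) => [s t est | s t]; first exact: (index_inj s (eI s) (eI t)).
have srt : sorted (relpre w <=%O) e by apply: sort_sorted => u v; exact: le_total.
have tr : transitive (relpre w <=%O) by move=> u v z; exact: le_trans.
have rf : reflexive (relpre w <=%O) by move=> u; exact: lexx.
exact: (sorted_leq_index tr rf srt s t (eI s) (eI t)).
Qed.

End Orthogonality.

(** * Orthogonal bases adapted to a linear map *)

Section SingularBases.
Variables (F : fieldType) (R : realType) (I J : finType).
Variables (wI : I -> R) (wJ : J -> R).
Local Open Scope ring_scope.
Local Notation VI := {ffun I -> F^o}.
Local Notation VJ := {ffun J -> F^o}.
Variables (f : 'Hom(VI, VJ)) (Z : {vspace VJ}).

(** This is [barcode_bases] for an arbitrary linear map between weighted function spaces, with [Z]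
    in the place of the cycles. *)
Record singular_bases (y : seq VI) (w : seq VJ) : Prop := SingularBases {
  singular_orth_y : weight_orthogonal wI y;
  singular_orth_w : weight_orthogonal wJ w;
  singular_y : basis_of fullv y;
  singular_w : basis_of Z w;
  singular_ker : basis_of (lker f) (drop (\dim (limg f)) y);
  singular_im : basis_of (limg f) (take (\dim (limg f)) w);
  singular_f : forall i, (i < \dim (limg f))%N -> f y`_i = w`_i }.

(** The least bound on the ranks in the support of [f y] exists by well-ordering. The bound is
    strict so that 0 can stand for [f y = 0]. *)
Lemma minimal_lead_lift (rhoI : I -> nat) (rhoJ : J -> nat) s :
  injective rhoI ->
  exists2 y : VI, lead rhoI y = Some s &
    forall (y' : VI) m, lead rhoI y' = Some s ->
      (forall t, f y' t != 0 -> (rhoJ t < m)%N) ->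
      forall t, f y t != 0 -> (rhoJ t < m)%N.
Proof.
move=> injI.
pose Q m := `[< exists2 y : VI, lead rhoI y = Some s &
                forall t, f y t != 0 -> (rhoJ t < m)%N >].
have exQ : exists m, Q m.
  exists (\max_t rhoJ t).+1; apply/asboolP; exists (delta F s).
    exact: lead_delta.
  by move=> t _; rewrite ltnS leq_bigmax.
case: (ex_minnP exQ) => m /asboolP[y ly my] minm; exists y => // y' m' ly' my' t fyt.
apply: leq_trans (my t fyt) (minm _ _).
by apply/asboolP; exists y'.
Qed.

(** Subtract from [y'] the multiple of [y] that cancels the image at [t]. The lead [s'] survives
    because the support of [y] has ranks at most that of [s]. *)
Lemma minimal_lift_distinct (rhoI : I -> nat) (rhoJ : J -> nat) (y y' : VI) s s' t :
  injective rhoI -> injective rhoJ ->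
  lead rhoI y = Some s -> lead rhoI y' = Some s' -> (rhoI s < rhoI s')%N ->
  lead rhoJ (f y) = Some t -> lead rhoJ (f y') = Some t ->
  exists2 y'' : VI, lead rhoI y'' = Some s' &
    forall u, f y'' u != 0 -> (rhoJ u < rhoJ t)%N.
Proof.
move=> injI injJ ly ly' lts lf lf'.
exists (y' - (f y' t / f y t) *: y).
  have ys' : y s' = 0.
    apply/eqP; apply: contraTT lts => ys'.
    by rewrite -leqNgt (lead_bounded injI ly).
  apply/eqP/leadP => //; split.
    by rewrite !ffunE ys' scaler0 subr0 (lead_neq0 injI ly').
  move=> u; have [y'u|y'u _] := eqVneq (y' u) 0; last exact: (lead_bounded injI ly').
  have [yu|yu _] := eqVneq (y u) 0; first by rewrite !ffunE y'u yu scaler0 subr0 eqxx.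
  by rewrite (leq_trans (lead_bounded injI ly yu)) // ltnW.
move=> u; rewrite linearB linearZ /= !ffunE => nz.
rewrite ltn_neqAle; apply/andP; split.
  apply: contra_neq nz => /injJ ->; rewrite [_ *: _]divfK ?subrr //.
  exact: (lead_neq0 injJ lf).
have [y'u|y'u] := eqVneq (f y' u) 0; last exact: (lead_bounded injJ lf').
have [yu|yu] := eqVneq (f y u) 0; last exact: (lead_bounded injJ lf).
by rewrite y'u yu scaler0 subr0 eqxx in nz.
Qed.

Lemma dim_ffun_full (K : finType) : \dim (fullv : {vspace {ffun K -> F^o}}) = #|K|.
Proof.
rewrite -(dim_supp_space F predT); congr (\dim _); apply/esym/vspaceP=> c.
by rewrite memvf; apply/supp_spaceP.
Qed.

(** Gaussian elimination: subtracting a multiple of the entry with the same lead lowers the greatest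
    rank in the support, on which the induction runs. *)
Lemma leads_span (K : finType) (rho : K -> nat) (U : {vspace {ffun K -> F^o}})
    (x : seq {ffun K -> F^o}) :
  injective rho -> {subset x <= U} ->
  (forall (u : {ffun K -> F^o}) s, u \in U -> lead rho u = Some s ->
     Some s \in map (lead rho) x) ->
  (U <= <<x>>)%VS.
Proof.
move=> injr xU lx; apply/subvP => u.
have [n] : exists n, forall s, u s != 0 -> (rho s < n)%N.
  by exists (\max_s rho s).+1 => s _; rewrite ltnS leq_bigmax.
elim: n u => [|n IHn] u un uU.
  have -> : u = 0; last exact: mem0v.
  by apply/ffunP=> s; rewrite ffunE; apply/eqP; apply: contraT => /un.
have [->|nzu] := eqVneq u 0; first exact: mem0v.
have [s es] := lead_exists injr nzu.
have /mapP[v vx /esym ev] := lx u s uU es.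
rewrite -[u](subrK ((u s / v s) *: v)); apply: memvD; last by rewrite memvZ ?memv_span.
apply: IHn; last by apply: memvB => //; apply: memvZ; exact: xU.
move=> t; rewrite !ffunE => nz.
have lts : (rho t <= rho s)%N.
  have [ut|ut] := eqVneq (u t) 0; last exact: (lead_bounded injr es).
  have [vt|vt] := eqVneq (v t) 0; last exact: (lead_bounded injr ev).
  by rewrite ut vt scaler0 subr0 eqxx in nz.
apply: leq_trans (_ : rho s <= n)%N; last exact: (un s (lead_neq0 injr es)).
rewrite ltn_neqAle lts andbT; apply: contra_neq nz => /injr ->.
by rewrite [_ *: _]divfK ?subrr // (lead_neq0 injr ev).
Qed.

Lemma singular_bases_exist : (limg f <= Z)%VS -> exists y w, singular_bases y w.
Proof.
move=> fZ; have [rhoI injI monoI] := compatible_rank wI.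
have [rhoJ injJ monoJ] := compatible_rank wJ.
have [Y YP] := @choice I VI (fun s y => lead rhoI y = Some s /\
    forall (y' : VI) m, lead rhoI y' = Some s ->
      (forall t, f y' t != 0 -> (rhoJ t < m)%N) ->
      forall t, f y t != 0 -> (rhoJ t < m)%N)
    (fun s => let: ex_intro2 y ly my := minimal_lead_lift rhoJ s injI in
              ex_intro _ y (conj ly my)).
(* Chains with nonzero image come first in [y], those in the kernel last, as [singular_bases]
   requires. *)
pose e1 := [seq s <- enum I | f (Y s) != 0].
pose e0 := [seq s <- enum I | ~~ (f (Y s) != 0)].
pose y := map Y (e1 ++ e0); pose b1 := [seq f (Y s) | s <- e1].
have pe : perm_eq (e1 ++ e0) (enum I).
  by rewrite perm_sym -(perm_filterC (fun s => f (Y s) != 0)) perm_refl.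
have dy : distinct_leads rhoI y.
  apply/andP; split.
    apply/mapP => -[s _ e]; have [ls _] := YP s.
    by have := lead_neq0 injI ls; rewrite -e ffunE eqxx.
  rewrite -map_comp (eq_map (g := Some)); last by move=> s /=; have [] := YP s.
  by rewrite map_inj_uniq ?(perm_uniq pe) ?enum_uniq // => ? ? [].
have db1 : distinct_leads rhoJ b1.
  apply/andP; split.
    by apply/mapP => -[s]; rewrite mem_filter => /andP[nz _] e; rewrite -e eqxx in nz.
  rewrite -map_comp map_inj_in_uniq; first by apply: filter_uniq; exact: enum_uniq.
  (* If two images shared a lead, [minimal_lift_distinct] would improve the chain with the higher
     lead, against its minimality. *)
  have main s s' t : lead rhoJ (f (Y s)) = Some t -> lead rhoJ (f (Y s')) = Some t ->
      (rhoI s' <= rhoI s)%N.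
    move=> lt lt'; rewrite leqNgt; apply/negP => lts.
    have [ls _] := YP s; have [ls' ms'] := YP s'.
    have [y'' ly'' my''] := minimal_lift_distinct injI injJ ls ls' lts lt lt'.
    by have := ms' _ _ ly'' my'' t (lead_neq0 injJ lt'); rewrite ltnn.
  move=> s s'; rewrite mem_filter => /andP[nz _] _ /= e.
  have [t lt] := lead_exists injJ nz.
  by apply/injI/eqP; rewrite eqn_leq (main s' s t) ?(main s s' t) // -e.
have fy := distinct_leads_free injI dy.
have basis_y : basis_of fullv y.
  rewrite basisEfree fy subvf /= dim_ffun_full size_map (perm_size pe).
  by rewrite -cardE leqnn.
have fe0 s : s \in e0 -> f (Y s) = 0.
  by rewrite mem_filter negbK => /andP[/eqP].
have bb1 : basis_of (limg f) b1.
  rewrite /basis_of (distinct_leads_free injJ db1) andbT.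
  rewrite -(span_basis basis_y) limg_span -map_comp map_cat span_cat.
  rewrite [X in (_ + X)%VS](_ : _ = 0%VS) ?addv0 //.
  apply/eqP; rewrite -subv0; apply/span_subvP => _ /mapP[s se ->].
  by rewrite /= fe0 ?mem0v.
have r1 : \dim (limg f) = size e1.
  by have := size_basis (X := in_tuple b1) bb1; rewrite size_map.
(* When no element of [Z] has lead [t], the value 0 is a mere placeholder. *)
have exU t : exists u : VJ, (exists2 z, z \in Z & lead rhoJ z = Some t) ->
    u \in Z /\ lead rhoJ u = Some t.
  have [[z zZ lz]|none] := pselect (exists2 z, z \in Z & lead rhoJ z = Some t).
    by exists z.
  by exists 0.
have [U UP] := choice exU.
(* Elements for the leads that occur in [Z] but not among the images complete [b1] to a basis of
   [Z]. *)
pose e2 := [seq t <- enum J | `[< exists2 z, z \in Z & lead rhoJ z = Some t >]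
                              && (Some t \notin map (lead rhoJ) b1)].
pose b2 := map U e2.
have e2P t : t \in e2 -> [/\ U t \in Z, lead rhoJ (U t) = Some t
     & Some t \notin map (lead rhoJ) b1].
  by rewrite mem_filter => /andP[/andP[/asboolP/UP[UZ lU] nb] _].
have lb2 : map (lead rhoJ) b2 = map Some e2.
  by rewrite -map_comp; apply/eq_in_map => t /e2P[].
have db : distinct_leads rhoJ (b1 ++ b2).
  case/andP: db1 => nb1 ub1; apply/andP; split.
    rewrite mem_cat negb_or nb1 /=; apply/mapP => -[t /e2P[_ lU _] e].
    by have := lead_neq0 injJ lU; rewrite -e ffunE eqxx.
  rewrite map_cat cat_uniq ub1 lb2 /= map_inj_uniq; last by move=> ? ? [].
  rewrite filter_uniq ?enum_uniq // andbT.
  by apply/hasPn => _ /mapP[t /e2P[_ _ nt] ->].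
have bZ : {subset b1 ++ b2 <= Z}.
  move=> v; rewrite mem_cat => /orP[vb|/mapP[t /e2P[UZ _ _] -> //]].
  by apply: (subvP fZ); rewrite (basis_mem bb1).
exists y, (b1 ++ b2); split.
- exact: distinct_leads_orthogonal injI monoI _ dy.
- exact: distinct_leads_orthogonal injJ monoJ _ db.
- exact: basis_y.
- rewrite /basis_of (distinct_leads_free injJ db) andbT eqEsubv.
  apply/andP; split; first exact/span_subvP.
  apply: (leads_span injJ bZ) => u t uZ lu; rewrite map_cat mem_cat lb2.
  have [//|nb] := boolP (Some t \in map (lead rhoJ) b1).
  apply/mapP; exists t => //; rewrite mem_filter nb mem_enum !andbT.
  by apply/asboolP; exists u.
- have -> : drop (\dim (limg f)) y = map Y e0.
    by rewrite r1 /y map_cat drop_size_cat ?size_map.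
  have fr0 : free (map Y e0) by apply: (catr_free (X := map Y e1)); rewrite -map_cat.
  rewrite basisEfree fr0 /=; apply/andP; split.
    by apply/span_subvP => _ /mapP[s se ->]; rewrite memv_ker fe0.
  (* By rank-nullity the kernel has dimension [size e0]. *)
  rewrite size_map -(leq_add2r (\dim (limg f))).
  have := limg_ker_dim f fullv; rewrite capfv => ->.
  by rewrite r1 addnC -size_cat (perm_size pe) -cardE dim_ffun_full.
- by rewrite r1 take_size_cat ?size_map.
- move=> i; rewrite r1 => lti.
  rewrite /y map_cat !nth_cat !size_map lti.
  (* The case split provides a default index for [nth_map]; an empty [e1] leaves no position [i]. *)
  case e1E: e1 lti => [|s0 e] lti //.
  by rewrite -e1E !(nth_map s0) ?e1E.
Qed.

Definition singular_values (y : seq VI) (w : seq VJ) : seq (\bar R * \bar R) :=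
  let r := \dim (limg f) in
  [seq (weight_filt wJ w`_i, weight_filt wI y`_i) | i <- iota 0 r] ++
  [seq (weight_filt wJ u, +oo%E) | u <- drop r w].

Definition singular_space (a b : \bar R) : {vspace VJ} :=
  ((if b == +oo%E then Z else f @: sublevel F wI b) :&: sublevel F wJ a)%VS.

(** Orthogonality enters twice. That of [y] shows that the image of a sublevel space is spanned by
    the [w_i] with [i < r] whose [y_i] lies in it; that of [w] then counts those below [a]. For
    infinite [b] only the second is needed. *)
Lemma count_singular_values y w a b : (limg f <= Z)%VS -> singular_bases y w ->
  count (fun p => (p.1 <= a)%E && (p.2 <= b)%E) (singular_values y w) =
  \dim (singular_space a b).
Proof.
move=> fZ [oy ow basis_y bw bk bi fyw]; set r := \dim (limg f) in bk bi fyw.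
have fw := basis_free bw; have fy := basis_free basis_y.
have rw : (r <= size w)%N.
  have -> : size w = \dim Z by rewrite -(size_basis (X := in_tuple w) bw).
  exact: dimvS.
have ry : (r <= size y)%N.
  have -> : size y = \dim {: VI} by rewrite -(size_basis (X := in_tuple y) basis_y).
  by rewrite -(limg_ker_dim f fullv) leq_addl.
have iw : iota 0 (size w) = iota 0 r ++ iota r (size w - r).
  by rewrite -{1}(subnKC rw) iotaD.
have dw : drop r w = [seq w`_i | i <- iota r (size w - r)].
  rewrite -{1}[w](mkseq_nth 0) /mkseq iw map_cat drop_size_cat //.
  by rewrite size_map size_iota.
rewrite /singular_values -/r count_cat !count_map /singular_space.
have [->|binf] := eqVneq b +oo%E.
  have -> : Z = <<[seq w`_i | i <- iota 0 (size w) & xpredT i]>>%VS.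
    by rewrite filter_predT -/(mkseq _ _) mkseq_nth (span_basis bw).
  rewrite dim_span_sublevel // iw count_cat dw count_map.
  by congr (_ + _)%N; apply: eq_count => i; rewrite /= leey andbT.
have cb : (f @: sublevel F wI b)%VS = <<[seq w`_i | i <- iota 0 (size w) &
      (i < r)%N && (weight_filt wI y`_i <= b)%E]>>%VS.
  rewrite -[sublevel F wI b]capfv -(span_basis basis_y) -{1}[y](mkseq_nth 0).
  rewrite /mkseq -{1}[iota _ _]filter_predT orthogonal_span_sublevel //=.
  rewrite limg_span -map_comp -{1}(subnKC ry) iotaD filter_cat map_cat span_cat.
  (* The entries of [y] from position [r] on lie in the kernel and contribute nothing to the
     image. *)
  rewrite [X in (_ + X)%VS](_ : _ = 0%VS) ?addv0; last first.
    apply/eqP; rewrite -subv0; apply/span_subvP => _ /mapP[i] + ->.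
    rewrite mem_filter mem_iota add0n subnKC // => /and3P[_ ri iy].
    rewrite memv0 /= -memv_ker (basis_mem bk) //.
    apply/(nthP 0); exists (i - r)%N.
      by rewrite size_drop ltn_sub2r // (leq_ltn_trans ri).
    by rewrite nth_drop subnKC.
  rewrite iw filter_cat [X in _ ++ X](_ : _ = [::]) ?cats0; last first.
    apply/eqP; rewrite -[_ == _]negbK -has_filter; apply/hasPn => i.
    by rewrite mem_iota => /andP[ri _]; rewrite ltnNge ri.
  congr (<<_>>)%VS.
  have -> : [seq i <- iota 0 r | (i < r)%N && (weight_filt wI y`_i <= b)%E] =
            [seq i <- iota 0 r | (weight_filt wI y`_i <= b)%E].
    by apply: eq_in_filter => i; rewrite mem_iota add0n /= => ->.
  apply/eq_in_map => i; rewrite mem_filter mem_iota add0n /= => /andP[_ ltir].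
  exact: fyw.
rewrite cb dim_span_sublevel // iw count_cat; congr (_ + _)%N.
  apply: eq_in_count => i; rewrite mem_iota add0n /= => ->.
  by rewrite andbC.
(* Bars with infinite death are not counted when [b] differs from [+oo]. *)
rewrite (eq_in_count (a2 := pred0)); last first.
  by move=> u _ /=; rewrite leye_eq (negPf binf) andbF.
rewrite count_pred0 (eq_in_count (a2 := pred0)) ?count_pred0 // => i.
by rewrite mem_iota => /andP[ri _] /=; rewrite ltnNge ri.
Qed.

End SingularBases.

(** * Multisets and cumulative counts *)

Section CumulativeCounts.
Variables (T : eqType) (le : rel T).
Hypotheses (le_refl : reflexive le) (le_anti : antisymmetric le)
  (le_tr : transitive le).

(** An entry with the fewest entries below it is minimal: passing to one strictly below would lose
    at least the entry itself. *)
Lemma minimal_member (s : seq T) : s != [::] ->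
  exists2 p, p \in s & {in s, forall q, le q p -> q = p}.
Proof.
move=> nz; pose g p := count (le^~ p) s.
have exm : exists m, has (fun p => g p == m) s.
  by case: s nz @g => // p s _ g; exists (g p); rewrite /= eqxx.
case: (ex_minnP exm) => m /hasP[p ps /eqP gp] minm; exists p => // q qs leqp.
apply/eqP; apply: contraT => neq.
suff : (g q < g p)%N.
  by rewrite ltnNge gp minm //; apply/hasP; exists q.
have nlepq : ~~ le p q.
  by apply: contra neq => lepq; apply/eqP/le_anti; rewrite leqp.
rewrite /g; have := count_predC (le^~ q) (filter (le^~ p) s).
rewrite !count_filter size_filter => <-.
rewrite (eq_count (a1 := predI (le^~ q) (le^~ p)) (a2 := le^~ q)); last first.
  by move=> u /=; case leuq: (le u q) => //=; exact: le_tr leuq leqp.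
rewrite -[X in (X < _)%N]addn0 ltn_add2l -has_count.
by apply/hasP; exists p => //=; rewrite nlepq le_refl.
Qed.

(** A minimal [p] of [s1] occurs in [s2]: the count at [p] gives some [q] in [s2] below [p], the
    count at [q] gives an entry of [s1] below [q], and minimality makes all three equal. Remove [p]
    from both lists and induct. *)
Lemma cumulative_count_perm (s1 s2 : seq T) :
  (forall a, count (le^~ a) s1 = count (le^~ a) s2) -> perm_eq s1 s2.
Proof.
elim: {s1}(size s1) {-2}s1 (erefl (size s1)) s2 => [|n IHn] s1 sz s2 cnt.
  case: s1 sz cnt => // _ cnt; case: s2 cnt => // p s2 /(_ p) /=.
  by rewrite le_refl.
have [|p ps minp] := @minimal_member s1; first by case: s1 sz {cnt}.
have ps2 : p \in s2.
  have : (0 < count (le^~ p) s1)%N.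
    by rewrite -has_count; apply/hasP; exists p => //=; exact: le_refl.
  rewrite cnt -has_count => /hasP[q qs2 /= leqp].
  have : (0 < count (le^~ q) s1)%N.
    by rewrite cnt -has_count; apply/hasP; exists q => //=; exact: le_refl.
  rewrite -has_count => /hasP[q' qs1 /= leqq].
  have eq' := minp q' qs1 (le_tr leqq leqp); rewrite eq' in leqq.
  by have <- : q = p by apply: le_anti; rewrite leqp.
have e1 := perm_to_rem ps; have e2 := perm_to_rem ps2.
rewrite (permPl e1) perm_sym (permPl e2) perm_cons perm_sym; apply: IHn.
  by rewrite size_rem // sz.
move=> a; have := cnt a; rewrite (permP e1) (permP e2) /=.
exact: addnI.
Qed.

End CumulativeCounts.

Section MultisetCounts.
Variable K : choiceType.
Local Open Scope mset_scope.
Implicit Types A B : {mset K}.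

Lemma count_msetD (P : pred K) A B :
  count P (A `+` B) = (count P A + count P B)%N.
Proof.
rewrite -count_cat; apply/permP/allP => x _ /=.
by rewrite count_cat !count_mem_mset msetE2.
Qed.

Lemma count_big_msetD (I : finType) (Q : pred I) (P : pred K) (G : I -> {mset K}) :
  count P (\big[msetD/mset0]_(i | Q i) G i) = (\sum_(i | Q i) count P (G i))%N.
Proof.
apply: (big_morph (fun A : {mset K} => count P A)); first exact: count_msetD.
by rewrite enum_mset0.
Qed.

Lemma count_mset1 (P : pred K) (a : K) : count P [mset a] = P a.
Proof. by rewrite enum_msetn /= addn0. Qed.

Lemma cumulative_count_mset (le : rel K) A B :
  reflexive le -> antisymmetric le -> transitive le ->
  (forall a, count (le^~ a) A = count (le^~ a) B) -> A = B.
Proof.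
move=> rf an tr cnt; rewrite -[A]seq_mset_id -[B]seq_mset_id.
by apply/eq_seq_msetP/(cumulative_count_perm rf an tr).
Qed.

End MultisetCounts.

(** * Contraction and wedge operators *)

Section ExteriorAlgebra.
Variables (F : fieldType) (T : finType).
Local Open Scope ring_scope.
Local Notation E := {ffun {set T} -> F^o}.
Implicit Types (c : E) (s t : {set T}) (u v x : T).

Lemma vertex_posU1 s x u : x \notin s ->
  vertex_pos (x |: s)%SET u = ((enum_rank x < enum_rank u) + vertex_pos s u)%N.
Proof.
move=> xs; rewrite /vertex_pos.
have [lxu|lxu] := boolP (enum_rank x < enum_rank u)%N.
  rewrite (_ : [set _ in _ | _]%SET =
               (x |: [set v in s | (enum_rank v < enum_rank u)%N])%SET).
    by rewrite cardsU1 inE (negPf xs).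
  by apply/setP=> v; rewrite !inE; have [->|] := eqVneq v x; rewrite ?lxu.
rewrite add0n; congr #|pred_of_set _|; apply/setP=> v; rewrite !inE.
by have [->|//] := eqVneq v x; rewrite (negPf lxu) !andbF.
Qed.

Lemma vertex_posU1_self s u : vertex_pos (u |: s)%SET u = vertex_pos s u.
Proof.
congr #|pred_of_set _|; apply/setP=> v; rewrite !inE.
by have [->|//] := eqVneq v u; rewrite ltnn !andbF.
Qed.

Lemma vertex_posD1_self s u : vertex_pos (s :\ u)%SET u = vertex_pos s u.
Proof.
congr #|pred_of_set _|; apply/setP=> v; rewrite !inE.
by have [->|//] := eqVneq v u; rewrite ltnn !andbF.
Qed.

Lemma enum_rank_ltn_neq u v : u != v ->
  (enum_rank u < enum_rank v)%N = ~~ (enum_rank v < enum_rank u)%N.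
Proof.
move=> nuv; rewrite -leqNgt ltn_neqAle andb_idl // => _.
by apply: contra_neq nuv => /ord_inj/enum_rank_inj.
Qed.

(** Functions on all subsets, the empty one included, form the exterior algebra on [T]. This is the
    interior product with the dual vector of [u], and [wedge_fun] is left multiplication by [u]. *)
Definition contraction_fun u c : E :=
  [ffun t : {set T} => if u \in t then 0 else (-1) ^+ vertex_pos t u * c (u |: t)%SET].

Definition wedge_fun u c : E :=
  [ffun s : {set T} => if u \in s then (-1) ^+ vertex_pos s u * c (s :\ u)%SET else 0].

Fact contraction_is_linear u : linear (contraction_fun u).
Proof.
move=> a c c'; apply/ffunP=> t; rewrite !ffunE; case: (u \in t).
  by rewrite scaler0 addr0.
by rewrite mulrDr -scalerAr.
Qed.

Fact wedge_is_linear u : linear (wedge_fun u).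
Proof.
move=> a c c'; apply/ffunP=> t; rewrite !ffunE; case: (u \in t).
  by rewrite mulrDr -scalerAr.
by rewrite scaler0 addr0.
Qed.

HB.instance Definition _ u :=
  GRing.isLinear.Build F E E _ (contraction_fun u) (contraction_is_linear u).
HB.instance Definition _ u :=
  GRing.isLinear.Build F E E _ (wedge_fun u) (wedge_is_linear u).

Local Notation contr := contraction_fun.
Local Notation wedge := wedge_fun.

(** Inserting the earlier of the two vertices shifts the position of the later one by one, and not
    conversely, so the two orders differ by a sign. *)
Lemma contractionN u v c : u != v -> contr u (contr v c) = - contr v (contr u c).
Proof.
move=> nuv; apply/ffunP=> t; rewrite !ffunE !inE (eq_sym v u) (negPf nuv) /=.
case: (boolP (u \in t)) => ut; case: (boolP (v \in t)) => vt;
  rewrite ?mulr0 ?oppr0 //.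
rewrite !vertex_posU1 // !exprD finset.setUCA (enum_rank_ltn_neq nuv).
by case: (_ < _)%N; ring.
Qed.

Lemma contractionK u c : contr u (contr u c) = 0.
Proof.
by apply/ffunP=> t; rewrite !ffunE finset.setU11 mulr0; case: ifP.
Qed.

Lemma wedgeK u c : wedge u (wedge u c) = 0.
Proof.
by apply/ffunP=> t; rewrite !ffunE finset.setD11 mulr0; case: ifP.
Qed.

Lemma wedge_contractionN u x c : u != x -> wedge x (contr u c) = - contr u (wedge x c).
Proof.
move=> nux; apply/ffunP=> s; rewrite !ffunE !inE nux (eq_sym x u) (negPf nux) /=.
case: (boolP (u \in s)) => us; case: (boolP (x \in s)) => xs;
  rewrite ?mulr0 ?oppr0 //.
have eD : ((u |: s) :\ x = u |: (s :\ x))%SET.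
  by apply/setP=> v; rewrite !inE; have [->|] := eqVneq v u; rewrite ?nux.
have es : vertex_pos s u =
    ((enum_rank x < enum_rank u) + vertex_pos (s :\ x)%SET u)%N.
  by rewrite -{1}(finset.setD1K xs) vertex_posU1 ?finset.setD11.
rewrite eD (vertex_posU1 _ us) es !exprD (enum_rank_ltn_neq nux).
by case: (_ < _)%N; ring.
Qed.

(** At each [t] only one term can be nonzero, the first if [u] is outside [t] and the second
    otherwise, and its two signs cancel. *)
Lemma contraction_wedge u c : contr u (wedge u c) + wedge u (contr u c) = c.
Proof.
apply/ffunP=> t; rewrite !ffunE finset.setU11 finset.setD11 vertex_posU1_self vertex_posD1_self.
have [ut|ut] := boolP (u \in t).
  by rewrite add0r mulrA -expr2 sqrr_sign mul1r finset.setD1K.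
by rewrite addr0 mulrA -expr2 sqrr_sign mul1r finset.setU1K.
Qed.

Definition total_bd_fun c : E := \sum_u contr u c.

Fact total_bd_is_linear : linear total_bd_fun.
Proof.
move=> a c c'; rewrite /total_bd_fun scaler_sumr -big_split.
by apply: eq_bigr => u _; rewrite linearP.
Qed.

HB.instance Definition _ :=
  GRing.isLinear.Build F E E _ total_bd_fun total_bd_is_linear.

Local Notation bdT := total_bd_fun.

Lemma total_bd_supp c t : bdT c t != 0 ->
  exists2 u, u \notin t & c (u |: t)%SET != 0.
Proof.
rewrite /bdT sum_ffunE => nz.
have [u] : exists u, contr u c t != 0.
  apply/existsP; apply: contraNT nz; rewrite negb_exists => /forallP z.
  by rewrite big1 // => u _; apply/eqP; rewrite -[_ == _]negbK.
rewrite ffunE; case: ifPn => [_|ut]; first by rewrite eqxx.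
by rewrite mulf_eq0 signr_eq0 /= => cu; exists u.
Qed.

Lemma contraction_total_bd z c : contr z (bdT c) = - bdT (contr z c).
Proof.
rewrite /bdT linear_sum -sumrN; apply: eq_bigr => u _ /=.
have [->|nuz] := eqVneq u z; first by rewrite contractionK oppr0.
by rewrite contractionN // eq_sym.
Qed.

(** Coning with apex [x] is a contracting homotopy of the augmented complex. *)
Lemma total_bd_wedge x c : bdT (wedge x c) = c - wedge x (bdT c).
Proof.
rewrite /bdT linear_sum -sumrN (bigD1 x) //= [in RHS](bigD1 x) //= addrA.
congr (_ + _); first by apply/eqP; rewrite eq_sym subr_eq contraction_wedge.
by apply: eq_bigr => u nux; rewrite wedge_contractionN // opprK.
Qed.

Lemma total_bdK c : bdT (bdT c) = 0.
Proof.
rewrite {1}/bdT (eq_bigr (fun z => - bdT (contr z c))); last first.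
  by move=> z _; rewrite contraction_total_bd.
rewrite sumrN; apply/eqP; rewrite oppr_eq0; apply/eqP.
(* The double sum is split by the order of its two indices; the halves cancel by anticommutation. *)
pose g u v := contr u (contr v c).
have -> : \sum_i bdT (contr i c) =
    \sum_i (\sum_(u | (enum_rank u < enum_rank i)%N) g u i +
    \sum_(u | (enum_rank i < enum_rank u)%N) g u i).
  apply: eq_bigr => i _; rewrite /bdT (bigID (fun u => enum_rank u < enum_rank i)%N) /=.
  congr (_ + _); rewrite (bigD1 i) ?ltnn //= contractionK add0r.
  apply: eq_bigl => u; rewrite -leqNgt (ltn_neqAle (enum_rank i)) andbC.
  by rewrite (inj_eq (inj_comp (@ord_inj _) enum_rank_inj)) eq_sym.
rewrite big_split /= [X in _ + X](exchange_big_dep predT) //= -big_split /=.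
apply: big1 => i _; rewrite -big_split /= big1 // => u ltui.
rewrite /g contractionN ?addNr //.
by apply: contraTneq ltui => ->; rewrite ltnn.
Qed.

Lemma contraction_notin z c : (forall s, c s != 0 -> z \notin s) -> contr z c = 0.
Proof.
move=> cz; apply/ffunP=> t; rewrite !ffunE; case: ifP => // _.
suff -> : c (z |: t)%SET = 0 by rewrite mulr0.
by apply/eqP; apply: contraT => /cz; rewrite finset.setU11.
Qed.

Lemma contraction_eq0 z c s : contr z c = 0 -> c s != 0 -> z \notin s.
Proof.
move=> /ffunP/(_ (s :\ z)%SET); rewrite !ffunE finset.setD11 => e cs.
apply/negP => zs; move/eqP: e; rewrite finset.setD1K // mulf_eq0 signr_eq0 /=.
exact/negP.
Qed.

End ExteriorAlgebra.

(** * Duplicating a point *)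

Section FullComplex.
Variables (F : fieldType) (R : realType) (T : finType) (d : T -> T -> R).
Local Open Scope ring_scope.
Local Notation E := {ffun {set T} -> F^o}.
Local Notation contr := (@contraction_fun F T).
Local Notation wedge := (@wedge_fun F T).
Local Notation bdT := (@total_bd_fun F T).
Implicit Types (c : E) (s t A : {set T}) (u v x z : T) (a b : \bar R).

(** As [h] need not be injective, this covers inclusions and embeddings as well as the collapse of a
    copy onto its original. *)
Lemma diam_map (T' : finType) (d' : T' -> T' -> R) (h : T -> T') s (s' : {set T'}) :
  {in s, forall u, h u \in s'} -> (forall u v, d u v = d' (h u) (h v)) ->
  diam d s <= diam d' s'.
Proof.
move=> hs dh; have ge0 : 0 <= diam d' s' by exact: bigmax_ge_id.
apply/bigmax_leP; split=> // u us; apply/bigmax_leP; split=> // v vs.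
rewrite dh; apply: le_trans (le_bigmax_cond _ _ (hs u us)).
exact: (le_bigmax_cond _ _ (hs v vs)).
Qed.

Lemma diamS s t : s \subset t -> diam d s <= diam d t.
Proof. by move=> /fintype.subsetP st; apply: (@diam_map _ d id). Qed.

Definition rips_simplex A k a : pred {set T} :=
  fun s => [&& s \subset A, #|s| == k.+1 & ((diam d s)%:E <= a)%E].

Definition rips_chains A k a : {vspace E} := supp_space F (rips_simplex A k a).

(* The total boundary is augmented, whereas every vertex is a cycle of the
   complex under study: a boundary carried by the empty set counts as zero. *)
Definition total_cycles : {vspace E} :=
  (linfun bdT @^-1: supp_space F (pred1 (finset.set0 : {set T})))%VS.

(** The counterpart of [singular_space] for the simplices on [A]; these spaces lie in one ambient
    space for all [A]. *)
Definition rips_space A k a b : {vspace E} :=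
  ((if b == +oo%E then total_cycles else linfun bdT @: rips_chains A k.+1 b)
   :&: rips_chains A k a)%VS.

Lemma rips_chains_bd A k a c : c \in rips_chains A k.+1 a -> bdT c \in rips_chains A k a.
Proof.
move/supp_spaceP => cP; apply/supp_spaceP => t /total_bd_supp[u ut /cP/and3P[sA cd da]].
apply/and3P; split; first exact: fintype.subset_trans (finset.subsetUr _ _) sA.
  by move: cd; rewrite cardsU1 ut.
apply: le_trans da; rewrite lee_fin; exact/diamS/finset.subsetUr.
Qed.

Lemma rips_chains_sub A A' k a a' : A \subset A' -> (a <= a')%E ->
  (rips_chains A k a <= rips_chains A' k a')%VS.
Proof.
move=> AA' aa'; apply/subvP => c /supp_spaceP cP; apply/supp_spaceP => s.
move=> /cP/and3P[sA cd da]; apply/and3P; split=> //.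
  exact: fintype.subset_trans AA'.
exact: le_trans aa'.
Qed.

Lemma total_bd_cycle c : bdT c \in total_cycles.
Proof. by rewrite -memv_preim lfunE /= total_bdK mem0v. Qed.

Lemma total_cyclesP c z : c \in total_cycles -> contr z (bdT c) = 0.
Proof.
rewrite -memv_preim lfunE /= => /supp_spaceP cP; apply: contraction_notin => s.
by move/cP/eqP => ->; rewrite finset.in_set0.
Qed.

Section AddCopy.
Variables (A : {set T}) (x z : T) (k : nat).
Hypotheses (xA : x \in A) (zA : z \notin A).
Hypothesis d_z : forall u, d z u = d x u /\ d u z = d u x.

Lemma copy_neq : z != x.
Proof. by apply: contraNneq zA => ->. Qed.

Lemma diam_collapse s s' : {in s, forall u, (if u == z then x else u) \in s'} ->
  diam d s <= diam d s'.
Proof.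
move=> h; apply: (@diam_map _ d (fun u => if u == z then x else u)) => // u v.
by case: eqP => [->|_]; case: eqP => [->|_]; rewrite ?(d_z _).1 ?(d_z _).2.
Qed.

Lemma diam_expand s s' : {in s, forall u, (if u == x then z else u) \in s'} ->
  diam d s <= diam d s'.
Proof.
move=> h; apply: (@diam_map _ d (fun u => if u == x then z else u)) => // u v.
by case: eqP => [->|_]; case: eqP => [->|_]; rewrite ?(d_z _).1 ?(d_z _).2.
Qed.

Lemma diam_copy s : diam d (z |: s)%SET = diam d (x |: s)%SET.
Proof.
apply/eqP; rewrite eq_le; apply/andP; split.
  apply: diam_collapse => u; rewrite !inE; case: eqP => _ /=.
    by rewrite eqxx.
  by move=> ->; rewrite orbT.
apply: diam_expand => u; rewrite !inE; case: eqP => _ /=.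
  by rewrite eqxx.
by move=> ->; rewrite orbT.
Qed.

Lemma diam_two_copies s : diam d (z |: (x |: s))%SET <= diam d (x |: s)%SET.
Proof.
apply: diam_collapse => u; rewrite !inE; case: eqP => _ /=.
  by rewrite eqxx.
by [].
Qed.

(* Reads off the coefficients of the simplices that contain z but not x. *)
Definition copy_coef_fun c : E := contr x (wedge x (contr z c)).

Fact copy_coef_is_linear : linear copy_coef_fun.
Proof. by move=> a c c'; rewrite /copy_coef_fun !linearP. Qed.

HB.instance Definition _ :=
  GRing.isLinear.Build F E E _ copy_coef_fun copy_coef_is_linear.

Definition copy_simplex a b : pred {set T} := fun beta =>
  [&& beta \subset (A :\ x)%SET, #|beta| == k, ((diam d (x |: beta)%SET)%:E <= a)%E
    & ((diam d (x |: beta)%SET)%:E <= b)%E].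

Lemma rips_chains_notin a l c : c \in rips_chains A l a -> contr z c = 0.
Proof.
move/supp_spaceP => cP; apply: contraction_notin => s /cP/and3P[/fintype.subsetP sA _ _].
by apply: contra zA => /sA.
Qed.

(* The chain map induced by the retraction sending z to x. *)
Definition collapse c : E := c - wedge z (contr z c) + wedge x (contr z c).

(** In a simplex with [z] but not [x], the vertex [z] is replaced by [x], which keeps the diameter;
    a simplex with both degenerates and is killed by [wedge x]. *)
Lemma collapse_rips a l c : c \in rips_chains (z |: A)%SET l a ->
  collapse c \in rips_chains A l a.
Proof.
move/supp_spaceP => cP.
have cz : contr z (collapse c) = 0.
  have xz : contr z (wedge x (contr z c)) = 0.
    apply: oppr_inj; rewrite -wedge_contractionN ?copy_neq //.
    by rewrite contractionK linear0 oppr0.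
  rewrite /collapse linearD linearB /= xz addr0.
  have /eqP := contraction_wedge z (contr z c).
  by rewrite contractionK linear0 addr0 => /eqP ->; rewrite subrr.
have sA s : s \subset (z |: A)%SET -> z \notin s -> s \subset A.
  move=> /fintype.subsetP sA zs; apply/fintype.subsetP => v vs; have := sA v vs.
  by rewrite !inE => /predU1P[e|//]; rewrite -e vs in zs.
apply/supp_spaceP => s nz; have zs := contraction_eq0 cz nz.
have ecs : collapse c s = c s + wedge x (contr z c) s.
  by rewrite /collapse !ffunE (negPf zs) subr0.
move: nz; rewrite ecs.
have [cs|/cP/and3P[ss cds das] _] := eqVneq (c s) 0; last first.
  by apply/and3P; split=> //; exact: sA.
rewrite cs add0r ffunE; case: ifP => [xs|_]; last by rewrite eqxx.
rewrite mulf_eq0 signr_eq0 ffunE; case: ifP => [_|zs']; first by rewrite eqxx.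
rewrite mulf_eq0 signr_eq0 /= => /cP/and3P[ss cds das]; apply/and3P; split.
- rewrite -(finset.setD1K xs) finset.subUset finset.sub1set xA /=; apply: sA; last by rewrite zs'.
  exact: fintype.subset_trans (finset.subsetUr _ _) ss.
- by rewrite -(finset.setD1K xs) cardsU1 finset.setD11; rewrite cardsU1 zs' in cds.
- by rewrite -(finset.setD1K xs) -diam_copy.
Qed.

(** The chain [contr z c] has zero boundary because contraction anticommutes with the boundary. The
    vanishing of [copy_coef_fun c] makes it a cone with apex [x], and by the homotopy formula for
    [x] such a cone with zero boundary is zero. *)
Lemma copy_coef_cycle_eq0 c a : c \in rips_chains (z |: A)%SET k a ->
  c \in total_cycles -> copy_coef_fun c = 0 -> contr z c = 0.
Proof.
move=> cA cZ c0; set w := contr z c.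
have bw : bdT w = 0.
  by apply: oppr_inj; rewrite -contraction_total_bd total_cyclesP // oppr0.
have xw : wedge x w = 0.
  have := contraction_wedge x w; rewrite -/(copy_coef_fun c) c0 add0r => <-.
  by rewrite wedgeK.
by have := total_bd_wedge x w; rewrite xw bw !linear0 addr0.
Qed.

(** By [copy_coef_cycle_eq0] a chain of the kernel avoids [z]. If it is the boundary of [e], it is
    also that of [collapse e]: then [contr z e] has zero boundary, so the cone removed and the cone
    added both have boundary [contr z e]. *)
Lemma rips_space_ker a b :
  (rips_space (z |: A)%SET k a b :&: lker (linfun copy_coef_fun))%VS = rips_space A k a b.
Proof.
have AzA : A \subset (z |: A)%SET by exact: finset.subsetUr.
apply/eqP; rewrite eqEsubv; apply/andP; split; apply/subvP => c; last first.
  rewrite !memv_cap => /andP[cB cA].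
  rewrite [_ \in lker (linfun copy_coef_fun)]memv_ker lfunE /=.
  apply/andP; split.
    apply/andP; split; last exact: (subvP (rips_chains_sub _ AzA (lexx a))).
    case: ifP cB => // _; apply: subvP; apply: limgS; exact: rips_chains_sub.
  by rewrite /copy_coef_fun (rips_chains_notin cA) !linear0.
rewrite !memv_cap => /andP[/andP[cB cA]].
rewrite [_ \in lker (linfun copy_coef_fun)]memv_ker lfunE /= => /eqP c0.
have cZ : c \in total_cycles.
  case: ifP cB => // _ /memv_imgP[e _ ->]; rewrite lfunE; exact: total_bd_cycle.
have cz := copy_coef_cycle_eq0 cA cZ c0.
apply/andP; split; last first.
  by have := collapse_rips cA; rewrite /collapse cz !linear0 !addr0.
case: ifP cB => // _ /memv_imgP[e eA ce]; rewrite lfunE /= in ce.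
apply/memv_imgP; exists (collapse e); first exact: collapse_rips.
have bze : bdT (contr z e) = 0.
  by apply: oppr_inj; rewrite -contraction_total_bd -ce cz oppr0.
rewrite lfunE /= /collapse linearD linearB /= !total_bd_wedge bze !linear0 !addr0.
by rewrite -ce subrK.
Qed.

Lemma rips_space_img a b :
  (linfun copy_coef_fun @: rips_space (z |: A)%SET k a b)%VS =
  supp_space F (copy_simplex a b).
Proof.
apply/eqP; rewrite eqEsubv; apply/andP; split; apply/subvP => g.
  case/memv_imgP => c; rewrite memv_cap => /andP[cB cA] ->; rewrite lfunE /=.
  have cb : b != +oo%E -> c \in rips_chains (z |: A)%SET k b.
    move=> nb; rewrite (negPf nb) in cB; case/memv_imgP: cB => e eA ->.
    by rewrite lfunE /=; exact: rips_chains_bd.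
  apply/supp_spaceP => s; rewrite !ffunE; case: ifPn => [_|xs]; first by rewrite eqxx.
  rewrite mulf_eq0 signr_eq0 /= finset.setU11 finset.setU1K // mulf_eq0 signr_eq0 /=.
  case: ifPn => [_|zs]; first by rewrite eqxx.
  rewrite mulf_eq0 signr_eq0 /= => cs.
  move/supp_spaceP: cA => /(_ _ cs)/and3P[/fintype.subsetP sA cd da]; apply/and4P; split.
  - apply/fintype.subsetP => v vs; have := sA v; rewrite !inE vs orbT => /(_ isT).
    rewrite andbC; case/predU1P => [e|->]; first by rewrite -e vs in zs.
    by apply: contraNneq xs => <-.
  - by move: cd; rewrite cardsU1 zs.
  - by rewrite -diam_copy.
  (* For infinite [b] the chain is only known to be a cycle, but the second bound is vacuous. *)
  have [->|nb] := eqVneq b +oo%E; first exact: leey.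
  by have /supp_spaceP/(_ _ cs)/and3P[_ _] := cb nb; rewrite diam_copy.
move/supp_spaceP => gP.
have xg : contr x g = 0.
  apply: contraction_notin => s /gP/and4P[/fintype.subsetP sA _ _ _].
  by apply/negP => /sA; rewrite !inE eqxx.
have zg : contr z g = 0.
  apply: contraction_notin => s /gP/and4P[/fintype.subsetP sA _ _ _].
  by apply/negP => /sA; rewrite !inE (negPf zA) andbF.
have xzg : contr z (wedge x g) = 0.
  apply: oppr_inj; rewrite -wedge_contractionN ?copy_neq //.
  by rewrite zg linear0 oppr0.
(* Stated for any bound [e], to be applied with [a] for the boundary and with [b] for the chain
   itself. *)
have hA e : (forall s, copy_simplex a b s -> ((diam d (x |: s)%SET)%:E <= e)%E) ->
    wedge z (wedge x g) \in rips_chains (z |: A)%SET k.+1 e.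
  move=> he; apply/supp_spaceP => s; rewrite ffunE; case: ifPn => [zs|]; last by rewrite eqxx.
  rewrite mulf_eq0 signr_eq0 ffunE; case: ifPn => [xs|]; last by rewrite eqxx.
  rewrite mulf_eq0 signr_eq0 /= => /gP gs; have /and4P[sA cd _ _] := gs.
  have es : s = (z |: (x |: (s :\ z :\ x)))%SET by rewrite !finset.setD1K.
  rewrite es; apply/and3P; split.
  - rewrite finset.setUS // finset.subUset finset.sub1set xA.
    by apply: fintype.subset_trans sA _; exact: finset.subsetDl.
  - by rewrite !cardsU1 (eqP cd) !inE (negPf copy_neq) !eqxx.
  - by apply: le_trans (he _ gs); rewrite lee_fin diam_two_copies.
have ba : bdT (wedge z (wedge x g)) \in rips_chains (z |: A)%SET k a.
  by apply: rips_chains_bd; apply: hA => s /and4P[].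
(* Contracting by [z] turns this, sign included, into the boundary of [wedge x g], which is
   [g - wedge x (bdT g)]. Wedging with [x] kills the correction, and contracting by [x] returns
   [g]. *)
apply/memv_imgP; exists (- bdT (wedge z (wedge x g))).
  rewrite memvN memv_cap ba andbT; case: ifP => _; first exact: total_bd_cycle.
  apply/memv_imgP; exists (wedge z (wedge x g)); last by rewrite lfunE.
  by apply: hA => s /and4P[].
rewrite lfunE /= /copy_coef_fun linearN /= contraction_total_bd opprK.
have -> : contr z (wedge z (wedge x g)) = wedge x g.
  by have := contraction_wedge z (wedge x g); rewrite xzg linear0 addr0.
rewrite total_bd_wedge linearB /= wedgeK subr0.
by have := contraction_wedge x g; rewrite xg linear0 addr0.
Qed.

Lemma dim_rips_space_copy a b :
  \dim (rips_space (z |: A)%SET k a b) =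
  (\dim (rips_space A k a b) + #|copy_simplex a b|)%N.
Proof.
by rewrite -(limg_ker_dim (linfun copy_coef_fun)) rips_space_ker rips_space_img
           dim_supp_space.
Qed.

End AddCopy.

End FullComplex.

(** * Simplicial chains inside the exterior algebra *)

Section Embedding.
Variables (F : fieldType) (R : realType) (T' T : finType) (h : T' -> T).
Variables (d' : T' -> T' -> R) (d : T -> T -> R).
Hypotheses (h_inj : injective h)
  (h_mono : forall u v, (enum_rank (h u) < enum_rank (h v))%N =
                        (enum_rank u < enum_rank v)%N)
  (h_dist : forall u v, d' u v = d (h u) (h v)).
Local Open Scope ring_scope.
Local Notation E := {ffun {set T} -> F^o}.
Local Notation bdT := (@total_bd_fun F T).
Let A : {set T} := (h @: [set: T'])%SET.

(** Used with [inl] for X and with the identity for Z, so that both barcodes are computed in the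
    exterior algebra on the points of Z. *)
Definition embed_fun k (c : chain F T' k) : E :=
  \sum_s c s *: delta F (h @: val s)%SET.

Fact embed_is_linear k : linear (@embed_fun k).
Proof.
move=> a c c'; rewrite /embed_fun scaler_sumr -big_split; apply: eq_bigr => s _.
by rewrite !ffunE scalerDl scalerA.
Qed.

HB.instance Definition _ k :=
  GRing.isLinear.Build F (chain F T' k) E _ (@embed_fun k) (@embed_is_linear k).

Lemma embed_coef k (c : chain F T' k) (s : simplex T' k) : embed_fun c (h @: val s)%SET = c s.
Proof.
rewrite /embed_fun sum_ffunE (bigD1 s) //= big1 => [|t nst].
  by rewrite !ffunE eqxx addr0 [_ *: _]mulr1.
rewrite !ffunE (inj_eq (finset.imset_inj h_inj)) (inj_eq val_inj) eq_sym (negPf nst).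
exact: scaler0.
Qed.

Lemma embed_inj k : injective (@embed_fun k).
Proof. by move=> c c' e; apply/ffunP=> s; rewrite -!embed_coef e. Qed.

Lemma embed_supp k (c : chain F T' k) t : embed_fun c t != 0 ->
  exists2 s : simplex T' k, t = (h @: val s)%SET & c s != 0.
Proof.
move=> nz; have [s /andP[/eqP -> cs]] :
    exists s : simplex T' k, (t == (h @: val s)%SET) && (c s != 0).
  apply/existsP; apply: contraNT nz; rewrite negb_exists => /forallP z.
  rewrite sum_ffunE big1 // => s _; rewrite !ffunE; have := z s.
  rewrite negb_and negbK => /orP[/negPf ->|/eqP ->]; first exact: scaler0.
  exact: scale0r.
by exists s.
Qed.

Lemma embed_onto k (e : E) :
  (forall t, e t != 0 -> (t \subset A) && (#|t| == k.+1)) ->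
  embed_fun [ffun s : simplex T' k => e (h @: val s)%SET] = e.
Proof.
move=> eP; apply/ffunP=> t.
have [e0|/eP/andP[tA ct]] := eqVneq (e t) 0.
  rewrite e0; apply/eqP; apply: contraT => /embed_supp[s ts].
  by rewrite ffunE -ts e0 eqxx.
have et : t = (h @: (h @^-1: t))%SET.
  apply/setP=> v; apply/idP/imsetP => [vt|[u]]; last by rewrite inE => ut ->.
  have /imsetP[u _ ev] := fintype.subsetP tA v vt.
  by exists u; rewrite // inE -ev.
have cs : #|(h @^-1: t)%SET| == k.+1.
  by rewrite -(card_imset _ h_inj) -et.
by rewrite {1}et -[(_ @^-1: _)%SET]/(val (exist (fun s : {set T'} => #|s| == k.+1) _ cs))
           embed_coef ffunE /= -et.
Qed.

Lemma vertex_pos_imset (s : {set T'}) v : vertex_pos (h @: s)%SET (h v) = vertex_pos s v.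
Proof.
rewrite /vertex_pos -(card_imset _ h_inj); congr #|pred_of_set _|; apply/setP=> u.
apply/idP/imsetP => [|[u' + ->]]; rewrite !inE.
  by case/andP=> /imsetP[u' us ->]; rewrite h_mono => lt; exists u' => //; rewrite inE us.
by case/andP=> us lt; rewrite h_mono lt imset_f.
Qed.

Lemma total_bd_delta (t : {set T}) :
  bdT (delta F t) = \sum_(v in t) (-1) ^+ vertex_pos t v *: delta F (t :\ v)%SET.
Proof.
rewrite [RHS]big_mkcond /total_bd_fun; apply: eq_bigr => v _; apply/ffunP=> u.
rewrite !ffunE; have [vt|vt] := boolP (v \in t); rewrite ffunE.
  rewrite ffunE; have [vu|vu] := boolP (v \in u).
    have [eu|_] := eqVneq u (t :\ v)%SET; last by rewrite scaler0.
    by rewrite eu finset.setD11 in vu.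
  have [->|nu] := eqVneq u (t :\ v)%SET.
    by rewrite finset.setD1K // eqxx vertex_posD1_self.
  have [eu|_] := eqVneq (v |: u)%SET t; last by rewrite mulr0 scaler0.
  by rewrite -eu finset.setU1K ?eqxx in nu.
case: ifP => // _; have [eu|_] := eqVneq (v |: u)%SET t; last by rewrite mulr0.
by rewrite -eu finset.setU11 in vt.
Qed.

Lemma embed_simplex_chain k (s : {set T'}) : #|s| = k.+1 ->
  embed_fun (simplex_chain F k s) = delta F (h @: s)%SET.
Proof.
move=> /eqP cs; rewrite /embed_fun (bigD1 (exist _ s cs)) //= big1 => [|t nst].
  by rewrite ffunE eqxx scale1r addr0.
by rewrite ffunE -[s]/(val (exist (fun s : {set T'} => #|s| == k.+1) s cs))
           (inj_eq val_inj) (negPf nst) scale0r.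
Qed.

(** The signs agree because [h] preserves the order of the vertices. The source degree is positive,
    so the augmentation does not interfere. *)
Lemma embed_bd k (c : chain F T' k.+1) : embed_fun (bd F T' k c) = bdT (embed_fun c).
Proof.
have ec : embed_fun c = \sum_s c s *: delta F (h @: val s)%SET by [].
rewrite lfunE /= ec /bd_fun !linear_sum; apply: eq_bigr => s _ /=.
rewrite !linearZ /= (linear_sum (@embed_fun k)) total_bd_delta big_imset /=; last first.
  by move=> ? ? _ _; exact: h_inj.
congr (_ *: _); apply: eq_bigr => v vs; rewrite (linearZ_LR (@embed_fun k)) /= vertex_pos_imset.
rewrite embed_simplex_chain; last first.
  by have := cardsD1 v (val s); rewrite vs (eqP (valP s)) => -[].
congr (_ *: delta F _); apply/setP=> u; rewrite !inE.
apply/imsetP/andP => [[u' + ->]|[nu /imsetP[u' us eu]]].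
  by rewrite !inE (inj_eq h_inj) => /andP[-> us]; split=> //; exact: imset_f.
by exists u' => //; rewrite !inE us andbT -(inj_eq h_inj) -eu.
Qed.

Lemma limg_bd_cycles k : (limg (bd F T' k) <= cycles F T' k)%VS.
Proof.
case: k => [|k]; first exact: subvf.
apply/subvP => _ /memv_imgP[c _ ->]; rewrite memv_ker; apply/eqP.
by apply: embed_inj; rewrite !embed_bd total_bdK linear0.
Qed.

(** In degree 0 the total boundary is carried by the empty set, so every chain qualifies. In higher
    degrees it is carried by nonempty sets, so it must vanish. *)
Lemma embed_total_cycles k (c : chain F T' k) :
  (embed_fun c \in total_cycles F T) = (c \in cycles F T' k).
Proof.
rewrite -memv_preim lfunE /=; case: k c => [|k] c.
  rewrite memvf; apply/supp_spaceP => t /total_bd_supp[u ut /embed_supp[s es _]].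
  have := card_imset (mem (val s)) h_inj; rewrite -es cardsU1 ut (eqP (valP s)).
  by move/eqP; rewrite add1n eqSS cards_eq0.
rewrite -embed_bd [RHS]memv_ker; apply/idP/eqP => [/supp_spaceP cP|->]; last first.
  by rewrite linear0 mem0v.
apply/ffunP=> s; rewrite ffunE -embed_coef; apply/eqP; apply: contraT => /cP /= /eqP e0.
by have := card_imset (mem (val s)) h_inj; rewrite e0 cards0 (eqP (valP s)).
Qed.

Lemma diam_imset (s : {set T'}) : diam d (h @: s)%SET = diam d' s.
Proof.
apply/eqP; rewrite eq_le; apply/andP; split; last first.
  by apply: (@diam_map _ _ _ _ _ h) => // u; exact: imset_f.
have ge0 : 0 <= diam d' s by exact: bigmax_ge_id.
apply/bigmax_leP; split=> // _ /imsetP[u us ->]; apply/bigmax_leP; split=> // _ /imsetP[v vs ->].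
rewrite -h_dist; apply: le_trans (le_bigmax_cond _ _ us).
exact: (le_bigmax_cond _ _ vs).
Qed.

Let weight k (s : simplex T' k) := diam d' (val s).

Lemma embed_sublevel k a :
  (linfun (@embed_fun k) @: sublevel F (@weight k) a)%VS = rips_chains F d A k a.
Proof.
apply/eqP; rewrite eqEsubv; apply/andP; split; apply/subvP => e.
  case/memv_imgP => c /supp_spaceP cP ->; rewrite lfunE /=.
  apply/supp_spaceP => t /embed_supp[s -> /cP wa]; apply/and3P; split.
  - by apply/fintype.subsetP => _ /imsetP[u _ ->]; rewrite imset_f ?inE.
  - by rewrite card_imset // (eqP (valP s)).
  - by rewrite diam_imset.
move/supp_spaceP => eP; apply/memv_imgP.
exists [ffun s : simplex T' k => e (h @: val s)%SET]; last first.
  by rewrite lfunE /= embed_onto // => t /eP/and3P[-> ->].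
by apply/supp_spaceP => s; rewrite ffunE => /eP/and3P[_ _]; rewrite diam_imset.
Qed.

(** The embedding is injective and commutes with the boundary, so it preserves dimensions,
    intersections and images. *)
Lemma dim_singular_space k a b :
  \dim (singular_space (@weight k.+1) (@weight k) (bd F T' k) (cycles F T' k) a b) =
  \dim (rips_space F d A k a b).
Proof.
have ker0 l : lker (linfun (@embed_fun l)) == 0%VS.
  by apply/lker0P => c c'; rewrite !lfunE; exact: embed_inj.
rewrite -(limg_dim_eq (f := linfun (@embed_fun k))); last first.
  by rewrite (eqP (ker0 k)) capv0.
congr (\dim _); rewrite lker0_img_cap // embed_sublevel /rips_space.
case: ifP => _; last first.
  congr (_ :&: _)%VS; rewrite -embed_sublevel -!limg_comp.
  by apply: eq_in_limg => c _; rewrite !comp_lfunE [LHS]lfunE [RHS]lfunE [in RHS]lfunE /= embed_bd.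
apply/vspaceP=> e; rewrite !memv_cap -embed_sublevel.
apply: andb_id2r => /memv_imgP[c _ ->]; rewrite [in RHS]lfunE /= embed_total_cycles.
apply/memv_imgP/idP => [[c' cc' e']|cc]; last by exists c.
by have <- : c' = c by apply: embed_inj; rewrite !lfunE in e'.
Qed.

Lemma count_verbose_barcode k a b :
  count (fun p => (p.1 <= a)%E && (p.2 <= b)%E) (verbose_barcode F d' k) =
  \dim (rips_space F d A k a b).
Proof.
(* Adapted bases exist, so [xget] does not return its default; the count is then the same for
   whichever bases it selects. *)
have ex : exists B, [set B | exists y w,
    @barcode_bases F R T' d' k y w /\ B = barcode_of_bases d' y w]%classic B.
  have [y [w [s1 s2 s3 s4 s5 s6 s7]]] :=
    singular_bases_exist (@weight k.+1) (@weight k) (limg_bd_cycles k).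
  by exists (barcode_of_bases d' y w), y, w; split=> //; split.
have [y [w [[s1 s2 s3 s4 s5 s6 s7]]]] := xgetPex mset0%mset ex.
rewrite -/(verbose_barcode F d' k) => ->.
rewrite (permP (perm_eq_seq_mset _)) -dim_singular_space.
by rewrite -(count_singular_values (y := y) (w := w) _ _ (limg_bd_cycles k)).
Qed.

End Embedding.

(** * Adding the copies one at a time *)

Lemma enum_rank_index (T : finType) (u : T) : enum_rank u = index u (enum T) :> nat.
Proof.
rewrite -{2}[u]enum_rankK (enum_val_nth u) index_uniq ?enum_uniq //.
by rewrite -cardE.
Qed.

(** The enumeration of a sum type lists the left summand first. Hence the inclusion of X in Z
    preserves the vertex order, as the embedding requires. *)
Lemma enum_rank_inl (T1 T2 : finType) (u : T1) :
  enum_rank (inl u : T1 + T2) = enum_rank u :> nat.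
Proof.
rewrite !enum_rank_index; rewrite [X in index _ X]enumT unlock /= /sum_enum.
rewrite index_cat map_f -?enumT ?mem_enum // index_map //.
by move=> ? ? [].
Qed.

Section Copies.
Variables (F : fieldType) (R : realType) (k n m : nat).
Variables (d : 'I_n -> 'I_n -> R) (j : 'I_m -> 'I_n).
Local Notation dZ := (copies_dist d j).
Local Notation Zt := ('I_n + 'I_m)%type.

(** All stages are subsets of the points of Z, so the ambient space stays fixed while copies are
    added. *)
Definition with_copies (l : nat) : {set Zt} :=
  [set z : Zt | if z is inr b then (b < l)%N else true]%SET.

Lemma with_copies0 : with_copies 0 = (inl @: [set: 'I_n])%SET.
Proof.
apply/setP=> -[a|b]; rewrite inE; first by rewrite imset_f ?inE.
by apply/esym/imsetP => -[].
Qed.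

Lemma with_copies_full : with_copies m = (id @: [set: Zt])%SET.
Proof.
by rewrite imset_id; apply/setP=> -[a|b]; rewrite !inE ?ltn_ord.
Qed.

Lemma with_copiesS (i : 'I_m) : with_copies i.+1 = (inr i |: with_copies i)%SET.
Proof.
apply/setP=> -[a|b]; rewrite !inE //.
by rewrite ltnS leq_eqVlt.
Qed.

Lemma stageE (i : 'I_m) : stage j i = (with_copies i :\ inl (j i))%SET.
Proof. by apply/setP=> -[a|b]; rewrite !inE ?andbT. Qed.

Lemma dim_rips_space_copies (a b : \bar R) (l : nat) : (l <= m)%N ->
  \dim (rips_space F dZ (with_copies l) k a b) =
  (\dim (rips_space F dZ (with_copies 0) k a b) +
   \sum_(i < m | (i < l)%N)
     #|copy_simplex dZ (with_copies i) (inl (j i)) k a b|)%N.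
Proof.
elim: l => [|l IHl] lm; first by rewrite big_pred0 ?addn0.
pose i := Ordinal lm.
rewrite -[l in LHS]/(val i) with_copiesS (@dim_rips_space_copy _ _ _ _ _ (inl (j i))).
- rewrite [val i]/= IHl 1?ltnW // -addnA; congr (_ + _)%N.
  rewrite [RHS](bigD1 i) //= addnC; congr (_ + _)%N.
  by apply: eq_bigl => i'; rewrite ltnS ltn_neqAle andbC.
- by rewrite inE.
- by rewrite inE ltnn.
by [].
Qed.

Lemma card_copy_simplex (a b : \bar R) (i : 'I_m) :
  #|copy_simplex dZ (with_copies i) (inl (j i)) k a b| =
  (\sum_(beta in subsets_of_card k (stage j i))
     (((diam dZ (inl (j i) |: beta)%SET)%:E <= a)%E &&
      ((diam dZ (inl (j i) |: beta)%SET)%:E <= b)%E))%N.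
Proof.
rewrite -sum1_card big_mkcond [RHS]big_mkcond; apply: eq_bigr => beta _.
rewrite inE stageE unfold_in /copy_simplex.
by case: (_ \subset _); case: (_ == _) => //=; case: (_ && _).
Qed.

Lemma verbose_barcode_copies :
  verbose_barcode F dZ k =
    (verbose_barcode F d k `+`
     \big[msetD/mset0]_(i < m)
       \big[msetD/mset0]_(beta in subsets_of_card k (stage j i))
         [mset ((diam dZ (inl (j i) |: beta)%SET)%:E,
                (diam dZ (inl (j i) |: beta)%SET)%:E)%E])%mset.
Proof.
(* In the product order on births and deaths, the count of the bars below [(a, b)] is the dimension
   of a [rips_space]. *)
pose le (p q : \bar R * \bar R) := ((p.1 <= q.1)%E && (p.2 <= q.2)%E).
apply: (@cumulative_count_mset _ le) => [p|p q|q p s|[a b]].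
- by rewrite /le !lexx.
- case: p q => [p1 p2] [q1 q2] /andP[/andP[/= h1 h2] /andP[/= h3 h4]].
  by congr (_, _); apply/eqP; rewrite eq_le ?h1 ?h2 ?h3 ?h4.
- by move=> /andP[h1 h2] /andP[h3 h4]; rewrite /le (le_trans h1 h3) (le_trans h2 h4).
rewrite count_msetD count_big_msetD /le /=.
rewrite (@count_verbose_barcode F R _ _ id dZ dZ (@inj_id _)) //.
have inl_inj : injective (@inl 'I_n 'I_m) by move=> ? ? [].
rewrite (@count_verbose_barcode F R _ _ inl d dZ inl_inj) //; last first.
  by move=> u v; rewrite !enum_rank_inl.
rewrite -with_copies_full -with_copies0 (dim_rips_space_copies a b (leqnn m)).
congr (_ + _)%N; apply: eq_big => [i|i _]; first by rewrite ltn_ord.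
rewrite card_copy_simplex count_big_msetD; apply: eq_bigr => beta _.
by rewrite count_mset1.
Qed.

End Copies.

Lemma subsets_of_card0 (T : finType) (A : {set T}) :
  subsets_of_card 0 A = [set finset.set0]%SET.
Proof.
apply/setP=> B; rewrite !inE cards_eq0.
by have [->|] := eqVneq B finset.set0; rewrite ?finset.sub0set ?andbF.
Qed.

Lemma diam_set1 (R : realType) (T : finType) (d : T -> T -> R) (u : T) :
  d u u = 0%R -> diam d [set u]%SET = 0%R.
Proof.
by move=> duu; rewrite /diam !big_set1E duu !maxxx.
Qed.

Theorem proposition1p3 (F : fieldType) (R : realType) (k n m : nat)
    (d : 'I_n -> 'I_n -> R) (j : 'I_m -> 'I_n)
    (hm : (1 <= m)%N)
    (hd : pseudometric d)
    (hj : forall a b : 'I_m, (a <= b)%N -> (j a <= j b)%N) :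
  let dZ := copies_dist d j in
  [/\ verbose_barcode F dZ k =
        (verbose_barcode F d k `+`
         \big[msetD/mset0]_(i < m)
           \big[msetD/mset0]_(beta in subsets_of_card k (stage j i))
             let D := (diam dZ (inl (j i) |: beta)%SET)%:E%E in
             [mset (D, D)])%mset,
      verbose_barcode F dZ 0 =
        (verbose_barcode F d 0 `+`
         \big[msetD/mset0]_(i < m)
           let D := (diam d [set (j i)]%SET)%:E%E in [mset (D, D)])%mset
    & (verbose_barcode F d 0 `+`
       \big[msetD/mset0]_(i < m)
         let D := (diam d [set (j i)]%SET)%:E%E in [mset (D, D)])%mset =
      (verbose_barcode F d 0 `+` msetn m (0%:E%E, 0%:E%E))%mset ].
Proof.
have dd := pseudometric_refl hd; split.
- exact: verbose_barcode_copies.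
- rewrite verbose_barcode_copies; congr msetD; apply: eq_bigr => i _.
  (* In degree 0 only the empty [beta] remains, and a single point has diameter 0 in both X and
     Z. *)
  rewrite subsets_of_card0 finset.big_set1 finset.setU0.
  by rewrite !diam_set1 // /copies_dist dd.
congr msetD; apply/msetP => p.
have -> : \big[msetD/mset0]_(i < m)
    (let D := (diam d [set (j i)]%SET)%:E%E in [mset (D, D)])%mset =
    \big[msetD/mset0]_(i < m) [mset (0%:E%E : \bar R, 0%:E%E : \bar R)]%mset.
  by apply: eq_bigr => i _; rewrite /= diam_set1.
rewrite -count_mem_mset count_big_msetD (eq_bigr (fun=> (p == (0%:E%E, 0%:E%E)) : nat)).
  by rewrite sum_nat_const card_ord msetnE; case: (p == _); rewrite ?muln1 ?muln0.
by move=> i _; rewrite count_mset1 /= eq_sym.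
Qed.
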